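(* Let $a_k(x)=\sum_{m=0}^k\binom{2k+2-m}{k-m}x^m$ for $k\ge 0$. Then for every integer $n\ge 0$, $$\det[a_{i+j}(-2)]_{0\le i,j\le n}=\frac13(2n+3)(1+2n^2).$$
   Context: The determinant is that of the $(n+1)\times(n+1)$ Hankel matrix with $(i,j)$ entry $a_{i+j}(-2)$, $0\le i,j\le n$. *)

(* Defs.v *)
From HB Require Import structures.
From mathcomp Require Import all_boot all_order all_algebra.

Set Implicit Arguments.
Unset Strict Implicit.
Unset Printing Implicit Defensive.

Import GRing.Theory.
Local Open Scope ring_scope.

(* Both natural-number subtractions are exact, since m <= k. *)
Definition a (R : comNzRingType) (k : nat) (x : R) : R :=
  \sum_(0 <= m < k.+1) 'C(2 * k + 2 - m, k - m)%:R * x ^+ m.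

Definition hankel (R : Type) (n : nat) (u : nat -> R) : 'M[R]_n.+1 :=
  \matrix_(i < n.+1, j < n.+1) u (i + j)%N.

(* Main.v *)
(** Let [L] be the linear functional on polynomials with moments
    [a_k(-2)], and [M] the one with moments [C(2k+1, k+1)].  The recurrence
    [3 a_{k+1}(-2) + 4 a_k(-2) = C(2k+5, k+3)] says that
    [L((3X+4) p) = M(X^2 p)].  With [X = t + 2 + 1/t], [M(f)] is half the
    constant term of [X f], whose orthogonal polynomials are the Chebyshev
    polynomials [V_n] of the third kind.  By Christoffel's formula, those
    of [M(X^2 .)] are [r_n = (V_{n+2} + alpha_n V_{n+1} + beta_n V_n) / X^2],
    with squared norms [beta_n].  Changing the basis to the [r_j] on one side
    and to [1, 3X+4, (3X+4) X, ...] on the other leaves in the last column of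
    the Hankel matrix only the entry [L(r_n)], whose minor is triangular with
    diagonal [beta_0, ..., beta_{n-1}].  Finally, [9 X^2 - 16] is a multiple of
    [3X+4], so [L(r_n) = 9/16 L(X^2 r_n)] for [n >= 2], and
    [L(V_{n+2}) = 4 (-3)^n]. *)

Require Import Defs.
From HB Require Import structures.
From mathcomp Require Import all_boot all_order all_algebra.
From mathcomp Require Import ring lra zify.

Set Implicit Arguments.
Unset Strict Implicit.
Unset Printing Implicit Defensive.

Import GRing.Theory Num.Theory.
Local Open Scope ring_scope.

(** * Linear functionals given by their moments *)

Definition mfun (R : comNzRingType) (u : nat -> R) (p : {poly R}) : R :=
  \sum_(i < size p) p`_i * u i.

Section MomentFunctional.
Variable R : comNzRingType.
Implicit Types (u : nat -> R) (p q : {poly R}).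

Lemma mfunE u p m : (size p <= m)%N -> mfun u p = \sum_(i < m) p`_i * u i.
Proof.
move=> le_pm; rewrite /mfun (big_ord_widen _ (fun i => p`_i * u i) le_pm).
rewrite big_mkcond /=; apply: eq_bigr => i _; case: ltnP => // le_pi.
by rewrite nth_default // mul0r.
Qed.

Lemma mfunD u p q : mfun u (p + q) = mfun u p + mfun u q.
Proof.
set m := maxn (size p) (size q).
rewrite !(@mfunE _ _ m) ?leq_maxl ?leq_maxr ?size_polyD // -big_split.
by apply: eq_bigr => i _; rewrite coefD mulrDl.
Qed.

Lemma mfunZ u c p : mfun u (c *: p) = c * mfun u p.
Proof.
rewrite (@mfunE _ _ (size p)) ?size_scale_leq // mulr_sumr.
by apply: eq_bigr => i _; rewrite coefZ mulrA.
Qed.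

Lemma mfunB u p q : mfun u (p - q) = mfun u p - mfun u q.
Proof. by rewrite -scaleN1r mfunD mfunZ mulN1r. Qed.

Lemma mfunXM u p : mfun u ('X * p) = mfun (u \o succn) p.
Proof.
rewrite (@mfunE _ _ (size p).+1); last first.
  by rewrite (leq_trans (size_polyMleq _ _)) // size_polyX.
rewrite big_ord_recl coefXM mul0r add0r; apply: eq_bigr => i _.
by rewrite coefXM.
Qed.

Lemma mfunXnM u k p : mfun u ('X^k * p) = mfun (fun i => u (k + i)%N) p.
Proof.
elim: k u => [|k IHk] u; first by rewrite mul1r.
by rewrite exprS -mulrA mfunXM IHk.
Qed.

Lemma mfun1 u : mfun u 1 = u 0%N.
Proof. by rewrite /mfun size_poly1 big_ord1 coef1 mul1r. Qed.

Lemma mfunXn u k : mfun u 'X^k = u k.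
Proof. by rewrite -[X in mfun u X]mulr1 mfunXnM mfun1 addn0. Qed.

Lemma mfun_lincomb u v c d p :
  mfun (fun i => c * u i + d * v i) p = c * mfun u p + d * mfun v p.
Proof.
rewrite /mfun !mulr_sumr -big_split; apply: eq_bigr => i _ /=; ring.
Qed.

End MomentFunctional.

(** * The recurrence for a_k(-2) *)

Lemma natr_binSS (R : comNzRingType) n k :
  'C(n.+2, k.+2)%:R = 'C(n, k.+2)%:R + 2 * 'C(n, k.+1)%:R + 'C(n, k)%:R :> R.
Proof.
have -> : 'C(n.+2, k.+2) = ('C(n, k.+2) + 2 * 'C(n, k.+1) + 'C(n, k))%N.
  by rewrite !binS; lia.
by rewrite 2!natrD natrM.
Qed.

(* [a k (-2)] is [bsum (2 * k + 2) k]; freeing the upper index makes Pascal's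
   rule available. *)
Definition bsum (N k : nat) : rat :=
  \sum_(0 <= m < k.+1) 'C(N - m, k - m)%:R * (- 2) ^+ m.

Lemma bsum_rec N k : bsum N.+1 k.+1 = 'C(N.+1, k.+1)%:R - 2 * bsum N k.
Proof.
rewrite /bsum big_nat_recl // !subn0 expr0 mulr1 -mulNr mulr_sumr; congr (_ + _).
by apply: eq_big_nat => i _; rewrite !subSS exprS; ring.
Qed.

(** Pascal's rule applies term by term for m <= k; the terms m = k + 1 on the two sides agree, their
    binomials being C(_, 0) = 1. *)
Lemma bsum_pascal N k : (k < N)%N -> bsum N.+1 k.+1 = bsum N k.+1 + bsum N k.
Proof.
move=> lt_kN; rewrite /bsum big_nat_recr //= [in RHS]big_nat_recr //= addrAC.
rewrite -big_split /= !subnn !bin0; congr (_ + _); apply: eq_big_nat => i /= lt_ik.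
by rewrite !subSn ?binS ?natrD ?mulrDl //; lia.
Qed.

Lemma bsum_succ N k : (k < N)%N -> bsum N k.+1 + 3 * bsum N k = 'C(N.+1, k.+1)%:R.
Proof. by move=> lt_kN; have := bsum_rec N k; rewrite bsum_pascal //; lra. Qed.

Lemma am2_rec k :
  3 * a k.+1 (-2 : rat) + 4 * a k (- 2) = 'C(2 * k + 5, k + 3)%:R.
Proof.
have aE j : a j (-2 : rat) = bsum (2 * j + 2) j by [].
rewrite !aE; case: k => [|k].
  rewrite /bsum /index_iota /= !big_cons !big_nil /=.
  by rewrite ?expr0 ?expr1 ?mulr1 ?addr0; vm_compute.
set N := (2 * k.+1 + 2)%N.
have -> : (2 * k.+2 + 2 = N.+2)%N by rewrite /N; lia.
have -> : (2 * k.+1 + 5 = N.+3)%N by rewrite /N; lia.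
have -> : (k.+1 + 3 = k.+4)%N by lia.
have lt_kN : (k.+2 < N)%N by rewrite /N; lia.
rewrite bsum_pascal; last by lia.
rewrite (@bsum_pascal N k.+1); last by lia.
rewrite (@bsum_pascal N k); last by lia.
(* With b_j = [bsum N j], the left side is now 3 b_{k+2} + 10 b_{k+1} + 3 b_k, that is, 3 times [h1]
   plus [h2]. The symmetry of binomial row N + 1 = 2k + 5 matches the right side. *)
have h1 := @bsum_succ N k.+1 ltac:(lia); have h2 := @bsum_succ N k ltac:(lia).
have s1 : 'C(N.+1, k.+4) = 'C(N.+1, k.+1).
  by rewrite -[RHS]bin_sub /N; [congr 'C(_, _)|]; lia.
have s2 : 'C(N.+1, k.+3) = 'C(N.+1, k.+2).
  by rewrite -[RHS]bin_sub /N; [congr 'C(_, _)|]; lia.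
rewrite natr_binSS s1 s2; lra.
Qed.

(** * Chebyshev polynomials of the third kind *)

Definition bseq (k : nat) : rat := 'C(2 * k + 1, k.+1)%:R.

(* [V_n(t + 2 + 1/t) = (t^(n+1/2) + t^(-n-1/2)) / (t^(1/2) + t^(-1/2))] *)
Fixpoint chebV (n : nat) : {poly rat} :=
  match n with
  | 0 => 1
  | S m => match m with
           | 0 => 'X - 3%:P
           | S p => ('X - 2%:P) * chebV m - chebV p
           end
  end.

Lemma chebV_rec n : chebV n.+2 = ('X - 2%:P) * chebV n.+1 - chebV n.
Proof. by []. Qed.

Lemma nat_ind2 (P : nat -> Prop) :
  P 0%N -> P 1%N -> (forall n, P n -> P n.+1 -> P n.+2) -> forall n, P n.
Proof.
move=> P0 P1 PSS n; suff [] : P n /\ P n.+1 by [].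
by elim: n => [|n [Pn PSn]]; split=> //; apply: PSS.
Qed.

Lemma chebV_monic_size n : chebV n \is monic /\ size (chebV n) = n.+1.
Proof.
elim/nat_ind2: n => [||n [_ sz0] [mon1 sz1]].
- by rewrite monic1 size_poly1.
- by rewrite monicXsubC size_XsubC.
have szM : size (('X - 2%:P) * chebV n.+1) = n.+3.
  by rewrite size_Mmonic ?polyXsubC_eq0 ?size_XsubC ?sz1.
have lt_sz : (size (- chebV n)%R < size (('X - 2%:P) * chebV n.+1)%R)%N.
  by rewrite size_polyN sz0 szM; lia.
rewrite chebV_rec monicE lead_coefDl // size_polyDl // szM; split=> //.
by rewrite -monicE monicMl ?monicXsubC.
Qed.

(** The value and derivative of V_n at 0 decide which combinations are divisible by X^2. *)
Lemma chebV_coef01 n :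
  (chebV n)`_0 = (-1) ^+ n * (2 * n%:R + 1) /\
  (chebV n)`_1 = - (-1) ^+ n * (n%:R * (n%:R + 1) * (2 * n%:R + 1) / 6).
Proof.
elim/nat_ind2: n => [||n [IH00 IH01] [IH10 IH11]].
- by rewrite !coef1 /=; split; field.
- by rewrite /= !coefB !coefX !coefC /=; split; field.
rewrite chebV_rec !coefB !mulrBl !coefB !coefXM !coefCM /= IH00 IH01 IH10 IH11.
by rewrite !exprS; split; field.
Qed.

Lemma mfunXnSM (u : nat -> rat) k (p : {poly rat}) :
  mfun u ('X^k * ('X * p)) = mfun u ('X^(k.+1) * p).
Proof. by rewrite mulrA -exprSr. Qed.

Lemma mfun_mulC (u : nat -> rat) k c (p : {poly rat}) :
  mfun u ('X^k * (c%:P * p)) = c * mfun u ('X^k * p).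
Proof. by rewrite mul_polyC -scalerAr mfunZ. Qed.

(** Half the constant term of X^(k+1) V_j is the coefficient of t^(j+1/2) in (t^(1/2) +
    t^(-1/2))^(2k+1). It vanishes for k < j and equals 1 for k = j. *)
Lemma mfun_bseq_chebV j k :
  mfun bseq ('X^k * chebV j) = 'C(2 * k + 1, k + j.+1)%:R.
Proof.
elim/nat_ind2: j k => [k|k|j IH0 IH1 k].
- by rewrite /= mulr1 mfunXn (addn1 k).
- have -> : chebV 1 = 'X * 1 - 3%:P * 1 by rewrite !mulr1.
  rewrite mulrBr mfunB mfunXnSM mfun_mulC !mulr1 !mfunXn /bseq.
  have -> : (2 * k.+1 + 1 = (2 * k + 1).+2)%N by lia.
  have -> : (k + 2 = k.+2)%N by lia.
  have s : 'C(2 * k + 1, k) = 'C(2 * k + 1, k.+1).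
    by rewrite -[RHS]bin_sub; [congr 'C(_, _)|]; lia.
  by rewrite natr_binSS s; ring.
rewrite chebV_rec mulrBl !mulrBr !mfunB mfunXnSM mfun_mulC !IH0 !IH1.
have -> : (2 * k.+1 + 1 = (2 * k + 1).+2)%N by lia.
have -> : (k.+1 + j.+2 = (k + j.+1).+2)%N by lia.
have -> : (k + j.+2 = (k + j.+1).+1)%N by lia.
have -> : (k + j.+3 = (k + j.+1).+2)%N by lia.
by rewrite natr_binSS; ring.
Qed.

(** * The functional with moments a_k(-2) *)

Local Notation am2 := (fun k => a k (-2 : rat)).

Lemma mfun_a_step p : mfun am2 ((3%:P * 'X + 4%:P) * p) = mfun bseq ('X^2 * p).
Proof.
rewrite mulrDl mfunD -mulrA !mul_polyC !mfunZ mfunXM mfunXnM.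
rewrite -mfun_lincomb; apply: eq_bigr => i _; congr (_ * _).
rewrite [LHS]am2_rec /bseq; congr ('C(_, _)%:R); lia.
Qed.

Lemma am2_values : [/\ am2 0 = 1, am2 1 = 2, am2 2 = 9 & am2 3 = 30].
Proof.
by rewrite /a /index_iota /= !big_cons !big_nil; split; vm_compute.
Qed.

(** For m >= 3, [mfun_a_step] at V_m gives C(5, m+3) = 0, so 3 L(V_{m+1}) + 10 L(V_m) + 3 L(V_{m-1})
    = 0. The characteristic roots are -3 and -1/3; the initial values 4 and -12 select -3. *)
Lemma mfun_a_chebV n : mfun am2 (chebV n.+2) = 4 * (-3) ^+ n.
Proof.
have [a0 a1 a2E a3] := am2_values.
have mX k : mfun am2 'X^k = a k (-2) by rewrite mfunXn.
elim/nat_ind2: n => [||n IH0 IH1].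
- have -> : chebV 2 = 'X^2 - 5 *: 'X^1 + 5 *: 'X^0 by rewrite /= -!mul_polyC; ring.
  by rewrite mfunD mfunB !mfunZ !mX a0 a1 a2E.
- have -> : chebV 3 = 'X^3 - 7 *: 'X^2 + 14 *: 'X^1 - 7 *: 'X^0.
    by rewrite /= -!mul_polyC; ring.
  by rewrite mfunB mfunD mfunB !mfunZ !mX a0 a1 a2E a3.
have := mfun_a_step (chebV n.+3); rewrite mfun_bseq_chebV bin_small //.
have -> : (3%:P * 'X + 4%:P) * chebV n.+3
    = 3 *: chebV n.+4 + 3 *: chebV n.+2 + 10 *: chebV n.+3.
  by rewrite [chebV n.+4]chebV_rec -!mul_polyC; ring.
rewrite 2!mfunD !mfunZ IH0 IH1 !exprS; lra.
Qed.

(** * The orthogonal polynomials r_n *)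

(* The unique coefficients for which [X^2] divides [orthp_comb n]. *)
Definition alpha (n : nat) : rat := (2 * n%:R + 5) / (n%:R + 1).
Definition beta (n : nat) : rat :=
  (2 * n%:R + 5) * (n%:R + 2) / ((2 * n%:R + 1) * (n%:R + 1)).

Definition orthp_comb n := chebV n.+2 + alpha n *: chebV n.+1 + beta n *: chebV n.
Definition orthp n : {poly rat} := drop_poly 2 (orthp_comb n).

Lemma den_neq0 n : (n%:R + 1 != 0 :> rat) /\ (2 * n%:R + 1 != 0 :> rat).
Proof. by split; apply: lt0r_neq0; have := ler0n rat n; lra. Qed.

(** The two lowest coefficients of [orthp_comb n] cancel, so [drop_poly 2] is exact division by
    X^2. *)
Lemma mulX2_orthp n : 'X^2 * orthp n = orthp_comb n.
Proof.
rewrite -[RHS](poly_take_drop 2) mulrC -[LHS]add0r; congr (_ + _).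
have [/= d1 d2] := den_neq0 n.
have [v0 w0] := chebV_coef01 n; have [v1 w1] := chebV_coef01 n.+1.
have [v2 w2] := chebV_coef01 n.+2.
apply/polyP => i; rewrite coef0 coef_take_poly; case: ltnP => // lt_i2.
case: i lt_i2 => [|[|//]] _; rewrite 2!coefD !coefZ.
  by rewrite v0 v1 v2 /alpha /beta !exprS; field; rewrite d1 d2.
by rewrite w0 w1 w2 /alpha /beta !exprS; field; rewrite d1 d2.
Qed.

Lemma orthp_monic_size n : orthp n \is monic /\ size (orthp n) = n.+1.
Proof.
have [_ sz0] := chebV_monic_size n; have [_ sz1] := chebV_monic_size n.+1.
have [mon2 sz2] := chebV_monic_size n.+2.
have lt_sz : (size (alpha n *: chebV n.+1 + beta n *: chebV n)%R
                < size (chebV n.+2))%N.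
  rewrite sz2 (leq_ltn_trans (size_polyD _ _)) // gtn_max.
  by rewrite !(leq_ltn_trans (size_scale_leq _ _)) ?sz0 ?sz1.
have mon : orthp_comb n \is monic.
  by rewrite monicE /orthp_comb -addrA lead_coefDl // -monicE.
have sz : size (orthp_comb n) = n.+3.
  by rewrite /orthp_comb -addrA size_polyDl // sz2.
split; last by rewrite size_drop_poly sz subn2.
by rewrite -(monicMr _ (monicXn _ 2)) mulrC mulX2_orthp.
Qed.

(** Against X^i with i <= n, V_{n+2} and V_{n+1} give 0, and V_n contributes only at i = n. *)
Lemma mfun_bseq_orthp i n : (i <= n)%N ->
  mfun bseq ('X^2 * ('X^i * orthp n)) = beta n * (i == n)%:R.
Proof.
move=> le_in; rewrite mulrCA mulX2_orthp /orthp_comb 2!mulrDr -!scalerAr 2!mfunD !mfunZ.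
rewrite !mfun_bseq_chebV.
rewrite !(@bin_small _ (i + _.+2)) ?(@bin_small _ (i + _.+3)); [|lia..].
rewrite mulr0 !add0r; congr (_ * _); case: eqVneq => [->|ne_in].
  by have -> : (2 * n + 1 = n + n.+1)%N by [lia]; rewrite binn.
by rewrite bin_small //; lia.
Qed.

Lemma mfun_a_orthp n :
  mfun am2 (orthp n.+2) = (-3) ^+ n.+2 / 4 * (9 - 3 * alpha n.+2 + beta n.+2).
Proof.
set N := n.+2.
(* Orthogonality kills both terms of (3X - 4) r_N, since the exponents 0 and 1 are below N >= 2. *)
have h : mfun am2 ((3%:P * 'X + 4%:P) * ((3%:P * 'X - 4%:P) * orthp N)) = 0.
  rewrite mfun_a_step.
  have -> : 'X^2 * ((3%:P * 'X - 4%:P) * orthp N) =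
      3 *: ('X^2 * ('X^1 * orthp N)) - 4 *: ('X^2 * ('X^0 * orthp N)).
    by rewrite -!mul_polyC; ring.
  by rewrite mfunB !mfunZ !mfun_bseq_orthp //= !mulr0 subr0.
have : mfun am2 (9 *: ('X^2 * orthp N) - 16 *: orthp N) = 0.
  by rewrite -[RHS]h; congr mfun; rewrite -!mul_polyC; ring.
rewrite mfunB !mfunZ mulX2_orthp 2!mfunD !mfunZ /N !mfun_a_chebV !exprS; lra.
Qed.

(** Telescoping: [beta j] is the ratio of the right-hand sides at j + 1 and j. *)
Lemma prod_beta n :
  \prod_(j < n) beta j = (2 * n%:R + 1) * (2 * n%:R + 3) * (n%:R + 1) / 3.
Proof.
elim: n => [|n IHn]; first by rewrite big_ord0; field.
have [d1 d2] := den_neq0 n.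
by rewrite big_ord_recr /= IHn /beta; field; rewrite d1 d2.
Qed.

(** * Evaluation of the determinant *)

Lemma det_utrig (R : comNzRingType) n (A : 'M[R]_n) :
  (forall i j : 'I_n, (j < i)%N -> A i j = 0) -> \det A = \prod_i A i i.
Proof.
move=> A0; rewrite -det_tr det_trig; last first.
  by apply/is_trig_mxP => i j lt_ij; rewrite mxE A0.
by apply: eq_bigr => i _; rewrite mxE.
Qed.

Lemma hankel_mul_coef (R : comNzRingType) n (u : nat -> R) (p : nat -> {poly R})
    (i j : 'I_n.+1) : (size (p j) <= n.+1)%N ->
  (hankel n u *m \matrix_(k, l) (p l)`_k) i j = mfun u ('X^i * p j).
Proof.
move=> le_pn; rewrite mxE mfunXnM (mfunE _ le_pn).
by apply: eq_bigr => k _; rewrite !mxE mulrC.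
Qed.

Lemma det_hankel_mfun n :
  3 ^+ n * \det (hankel n am2)
  = (-1) ^+ n * mfun am2 (orthp n) * \prod_(j < n) beta j.
Proof.
pose Q : 'M[rat]_n.+1 := \matrix_(k, l) (orthp l)`_k.
(* Row 0 holds the coefficients of 1, and row i > 0 those of (3X + 4) X^(i-1). *)
pose A : 'M[rat]_n.+1 := \matrix_(i, j)
  if i == ord0 then (j == ord0)%:R
  else 3 * (i == j)%:R + 4 * (i == j.+1 :> nat)%:R.
have detQ : \det Q = 1.
  rewrite det_utrig => [|i j lt_ji].
    apply: big1 => i _; rewrite mxE; have [mon sz] := orthp_monic_size i.
    by move/monicP: mon; rewrite lead_coefE sz.
  by rewrite mxE nth_default // (orthp_monic_size j).2.
have detA : \det A = 3 ^+ n.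
  rewrite det_trig.
    rewrite big_ord_recl mxE eqxx mul1r (eq_bigr (fun=> 3)) ?prodr_const ?card_ord //.
    move=> i _; rewrite mxE /= eqxx; case: eqP => [/eqP|_]; first by lia.
    by rewrite mulr1 mulr0 addr0.
  apply/is_trig_mxP => i j lt_ij; rewrite mxE.
  have -> : (j == ord0) = false by apply/negbTE; rewrite -val_eqE /=; lia.
  rewrite -[i == j]val_eqE /= !ltn_eqF ?mulr0 ?addr0 ?if_same //; lia.
have HQ i j : (hankel n am2 *m Q) i j = mfun am2 ('X^i * orthp j).
  by apply: hankel_mul_coef; rewrite (orthp_monic_size j).2.
pose B := A *m (hankel n am2 *m Q).
have B0 j : B ord0 j = mfun am2 (orthp j).
  rewrite mxE big_ord_recl big1 => [|k _]; first by rewrite HQ mxE !eqxx !mul1r addr0.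
  by rewrite mxE eqxx mul0r.
have BS (i : 'I_n) j : B (lift ord0 i) j = mfun bseq ('X^2 * ('X^i * orthp j)).
  (* Columns i and i + 1 carry the only nonzero entries of row i + 1 of [A]; being distinct, they
     can be split off the sum one after the other. *)
  have neq : widen_ord (leqnSn n) i != lift ord0 i.
    by rewrite -val_eqE /= /bump /=; lia.
  rewrite mxE (bigD1 (lift ord0 i)) //= (bigD1 (widen_ord (leqnSn n) i)) //=.
  rewrite big1 => [|k /andP[ne1 ne2]].
    rewrite !HQ !mxE /= eqxx [lift _ _ == widen_ord _ _]eq_sym (negPf neq).
    rewrite /bump /= add1n eqxx [_ == _.+2](ltn_eqF (ltnSn _)).
    rewrite -mfun_a_step [in RHS]mulrDl mfunD -[3%:P * _ * _]mulrA !mul_polyC !mfunZ.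
    by rewrite (mulrA _ _ (orthp j)) -exprS !(mulr0, mulr1, addr0, add0r).
  rewrite !mxE /= [lift _ _ == k]eq_sym (negPf ne1) mulr0 add0r.
  have -> : (bump 0 i == k.+1) = false.
    by apply/negbTE; move: ne2; rewrite -val_eqE /= /bump /=; lia.
  by rewrite mulr0 mul0r.
have <- : \det B = 3 ^+ n * \det (hankel n am2).
  by rewrite !det_mulmx detA detQ mulr1.
clearbody B.
(* In the last column, row i + 1 is [beta n * (i == n)] with i < n, hence 0. The minor of the
   remaining top entry is lower triangular. *)
rewrite (expand_det_col B ord_max) big_ord_recl big1 => [|i _].
  rewrite addr0 B0 /cofactor add0n mulrCA mulrA; congr (_ * _).
  rewrite det_trig; last apply/is_trig_mxP => i j lt_ij.
    by apply: eq_bigr => i _; rewrite !mxE BS mfun_bseq_orthp lift_max // eqxx mulr1.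
  have le_ij : (i <= lift ord_max j)%N by rewrite lift_max ltnW.
  by rewrite !mxE BS (mfun_bseq_orthp le_ij) lift_max (ltn_eqF lt_ij) mulr0.
by rewrite BS mfun_bseq_orthp ?ltn_eqF ?mulr0 ?mul0r //= ltnW.
Qed.

Theorem corollary2 (n : nat) :
  \det (hankel n (fun k => a k (- 2 : rat)))
  = 1 / 3 * (2 * n%:R + 3) * (1 + 2 * n%:R ^+ 2).
Proof.
have [a0 a1 a2E a3] := am2_values.
(* The formula for L(r_n) requires n >= 2; the two smaller determinants are computed directly. *)
case: n => [|[|n]].
- by rewrite det_mx11 mxE a0; field.
- rewrite (expand_det_row _ ord0) !big_ord_recl big_ord0 /cofactor !det_mx11 !mxE /=.
  by rewrite a0 a1 a2E; field.
set N := n.+2; have n3 : (3 : rat) ^+ N != 0 by rewrite expf_neq0.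
apply: (mulfI n3); rewrite det_hankel_mfun mfun_a_orthp prod_beta /alpha /beta.
have [d1 d2] := den_neq0 N.
have -> : (-3 : rat) ^+ N = (-1) ^+ N * 3 ^+ N by rewrite -exprMn mulN1r.
have : (-1 : rat) ^+ N * (-1) ^+ N = 1 by rewrite -exprMn mulrNN mulr1 expr1n.
move: n3 d1 d2; move: (_ ^+ N) (3 ^+ N) (N%:R) => s t x _ d1 d2 ss1.
(* The factor s * s = 1 collects the two signs (-1)^N, so that [field] can treat s and t as
   indeterminates. *)
transitivity (s * s * (t * (1 / 3 * (2 * x + 3) * (1 + 2 * x ^+ 2)))).
  by field; rewrite d1 d2.
by rewrite ss1 mul1r.
Qed.
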